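(* Let $\mathbb{K}$ be an algebraically closed field of characteristic zero, $V$ a finite-dimensional $\mathbb{K}$-vector space, $S=\mathbb{K}[V]$ its coordinate ring, and $R$ a pseudo-reflection on $V$, with induced maps $R:V^*\to V^*$ and $R:S\to S$. Fix a non-zero $l_R\in\mathrm{Im}(I-R)\subset V^*$. Then there exists a twisted derivation $D_R:S\to S$ with respect to $R$ such that for each $f\in S$, $$R(f)=f-D_R(f)\,l_R.$$
   Context: A linear automorphism $R$ of $V$ is a pseudo-reflection if $R^m=I$ for some positive integer $m$ and $\mathrm{Im}(I-R)$ is one-dimensional. It induces an automorphism of $V^*$, also denoted $R$, by $R(x)(v)=x(R^{-1}v)$ for $x\in V^*$, $v\in V$, which is again a pseudo-reflection (so $\mathrm{Im}(I-R)\subset V^*$ is one-dimensional). $S=\mathbb{K}[V]=\mathbb{K}[x_1,\dots,x_n]$ is the polynomial algebra on a basis $x_1,\dots,x_n$ of $V^*$, and $R:S\to S$ is the $\mathbb{K}$-algebra homomorphism extending $R:V^*\to V^*$. A linear map $D:S\to S$ is a twisted derivation with respect to $R$ if $D(fg)=D(f)g+R(f)D(g)$ for all $f,g\in S$. *)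

(* Defs.v *)
From HB Require Import structures.
From mathcomp Require Import all_boot all_order all_algebra.
From mathcomp Require Import mpoly.

Set Implicit Arguments.
Unset Strict Implicit.
Unset Printing Implicit Defensive.

Import GRing.Theory.
Local Open Scope ring_scope.

Section PseudoReflection.

Variables (K : fieldType) (V : vectType K).

Definition pseudo_reflection (R : 'End(V)) : Prop :=
  [/\ lker R == 0%VS,
      exists2 m : nat, (0 < m)%N & iter m R =1 id
    & \dim (limg (\1 - R)%VF) = 1%N].

(* V^* is 'Hom(V, K^o); the exponent -1 is a two-sided inverse of R as soon as
   lker R == 0. *)
Definition dual_fun (R : 'End(V)) (x : 'Hom(V, K^o)) : 'Hom(V, K^o) :=
  (x \o R^-1)%VF.

Fact dual_fun_is_linear R : linear (dual_fun R).
Proof. by move=> a x y; rewrite /dual_fun comp_lfunDl comp_lfunZl. Qed.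

HB.instance Definition _ R :=
  GRing.isLinear.Build K 'Hom(V, K^o) 'Hom(V, K^o) _ (dual_fun R)
    (dual_fun_is_linear R).

Definition dual_map (R : 'End(V)) : 'End('Hom(V, K^o)) := linfun (dual_fun R).

Lemma dual_mapE R (x : 'Hom(V, K^o)) v : dual_map R x v = x ((R^-1)%VF v).
Proof. by rewrite lfunE /= comp_lfunE. Qed.

End PseudoReflection.

Section CoordinateRing.

Variables (K : fieldType) (V : vectType K) (n : nat).
Variable X : n.-tuple 'Hom(V, K^o).

(* When X is a basis of V^*, the coordinate ring K[V] is {mpoly K[n]}, with 'X_i
   standing for the linear form X`_i; this is the inclusion of V^* in K[V]. *)
Definition form_poly (x : 'Hom(V, K^o)) : {mpoly K[n]} :=
  \sum_(i < n) coord X i x *: 'X_i.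

(* The K-algebra endomorphism of K[V] sending each 'X_i to the image of X`_i
   under the dual map. *)
Definition poly_map (R : 'End(V)) : {mpoly K[n]} -> {mpoly K[n]} :=
  comp_mpoly [tuple form_poly (dual_map R X`_i) | i < n].

HB.instance Definition _ R := GRing.LRMorphism.copy (poly_map R)
  (comp_mpoly [tuple form_poly (dual_map R X`_i) | i < n]).

Hypothesis basisX : basis_of fullv X.

Lemma form_polyX (i : 'I_n) : form_poly X`_i = 'X_i.
Proof.
rewrite /form_poly (bigD1 i) //= coord_free ?(basis_free basisX) // eqxx scale1r.
rewrite big1 ?addr0 // => j neq_ji.
by rewrite coord_free ?(basis_free basisX) // eq_sym (negbTE neq_ji) scale0r.
Qed.

Lemma form_poly_eval (x : 'Hom(V, K^o)) (v : V) :
  (form_poly x).@[fun i => X`_i v] = x v.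
Proof.
rewrite {2}(coord_basis basisX (memvf x)) sum_lfunE /form_poly rmorph_sum /=.
by apply: eq_bigr => i _; rewrite mevalZ mevalXU scale_lfunE.
Qed.

Lemma poly_map_form R (x : 'Hom(V, K^o)) :
  poly_map R (form_poly x) = form_poly (dual_map R x).
Proof.
rewrite {1}/form_poly linear_sum /=.
under eq_bigr => i _ do
  rewrite linearZ /= /poly_map comp_mpolyXU -tnth_nth tnth_mktuple scaler_sumr.
rewrite exchange_big; apply: eq_bigr => j _ /=.
rewrite [in RHS](coord_basis basisX (memvf x)) !linear_sum scaler_suml /=.
by apply: eq_bigr => i _; rewrite !linearZ /= scalerA mulrC.
Qed.

End CoordinateRing.

Definition twisted_derivation (K : fieldType) (S : lalgType K) (R : S -> S)
    (D : {linear S -> S}) : Prop :=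
  forall f g : S, D (f * g) = D f * g + R f * D g.

(* Main.v *)
(** If [Im(I - R)] is spanned by [u], then [x - R x = (x(u) / y(u)) l] for every
    [x] in [V^*], where [l = y - R y].  So [l] divides [f - R f] when [f] is a
    variable, hence, by [fg - R(f)R(g) = (f - R f) g + R(f) (g - R g)], for every
    [f].  The quotient of [f - R f] by [l] is [D f]; linearity and the twisted
    Leibniz rule follow by cancelling [l] in the domain [S]. *)
Require Import Defs.
From HB Require Import structures.
From mathcomp Require Import all_boot all_order all_algebra.
From mathcomp Require Import mpoly ring.

Import GRing.Theory.
Local Open Scope ring_scope.

(** The [f] for which [L] divides [f - T f] form a subalgebra; once it contains the variables, it is
    the whole polynomial ring. *)
Lemma dvd_sub_lrmorphism (K : fieldType) (n : nat)
    (T : {lrmorphism {mpoly K[n]} -> {mpoly K[n]}}) (L : {mpoly K[n]}) :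
    (forall i : 'I_n, exists g, g * L = 'X_i - T 'X_i) ->
  forall f, exists g, g * L = f - T f.
Proof.
move=> dvdX.
have dvdM f1 f2 : (exists g, g * L = f1 - T f1) ->
    (exists g, g * L = f2 - T f2) -> exists g, g * L = f1 * f2 - T (f1 * f2).
  move=> [g1 e1] [g2 e2]; exists (g1 * f2 + T f1 * g2).
  by rewrite rmorphM mulrDl mulrAC e1 -mulrA e2; ring.
have dvd1 : exists g, g * L = 1 - T 1.
  by exists 0; rewrite rmorph1 subrr mul0r.
elim/mpolyind => [|c m p _ _ [g eg]].
  by exists 0; rewrite linear0 subrr mul0r.
have [h eh] : exists g, g * L = 'X_[m] - T 'X_[m].
  rewrite mpolyXE_id; elim/big_ind: _ => // i _.
  by elim: (m i) => [|k IHk]; rewrite ?expr0 // exprS; apply: dvdM.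
exists (c *: h + g).
by rewrite linearP mulrDl -scalerAl eg eh scalerBr opprD addrACA.
Qed.

Lemma twisted_derivation_quotient (K : fieldType) (n : nat)
    (T : {lrmorphism {mpoly K[n]} -> {mpoly K[n]}}) (L : {mpoly K[n]}) :
    L != 0 -> (forall f, exists g, g * L = f - T f) ->
  exists D : {linear {mpoly K[n]} -> {mpoly K[n]}},
    twisted_derivation T D /\ (forall f, T f = f - D f * L).
Proof.
move=> L_neq0 dvdL.
(* The boolean form of the equation lets [xchoose] select a quotient. As [L] is nonzero in a domain,
   that quotient is unique, so the pointwise choices fit together linearly. *)
have dvdLb f : exists g, g * L == f - T f by have [g /eqP] := dvdL f; exists g.
pose d f := xchoose (dvdLb f).
have dE f : d f * L = f - T f by apply/eqP/(xchooseP (dvdLb f)).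
have d_lin : linear d.
  move=> a f g; apply: (mulIf L_neq0).
  by rewrite mulrDl -scalerAl !dE linearP scalerBr opprD addrACA.
pose D : {linear {mpoly K[n]} -> {mpoly K[n]}} :=
  HB.pack d (GRing.isLinear.Build K _ _ _ d d_lin).
exists D; split=> [f g|f] /=; last by rewrite dE subKr.
apply: (mulIf L_neq0).
rewrite mulrDl (mulrAC (d f)) -(mulrA (T f)) !dE rmorphM.
by rewrite mulrBl mulrBr addrA subrK.
Qed.

Lemma form_poly_linear (K : fieldType) (V : vectType K) (n : nat)
    (X : n.-tuple 'Hom(V, K^o)) :
  linear (form_poly X).
Proof.
move=> a x y; rewrite /form_poly scaler_sumr -big_split /=.
by apply: eq_bigr => i _; rewrite linearP scalerDl scalerA.
Qed.

(** Evaluating the polynomial at the coordinates of [v] gives back [l v], so a zero polynomial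
    forces [l] to vanish everywhere. *)
Lemma form_poly_neq0 (K : fieldType) (V : vectType K) (n : nat)
    (X : n.-tuple 'Hom(V, K^o)) (l : 'Hom(V, K^o)) :
  basis_of fullv X -> l != 0 -> form_poly X l != 0.
Proof.
move=> basisX; apply: contraNneq => l0; apply/eqP/lfunP => v.
by rewrite -(form_poly_eval basisX) l0 meval0 lfunE.
Qed.

(** The value of x - R x at v is x(v - R^-1 v), and v - R^-1 v lies on the line Im(I - R). So x - R
    x is x(u) times a linear form that does not depend on x. *)
Lemma sub_dual_map_colinear (K : fieldType) (V : vectType K) (R : 'End(V))
    (l x : 'Hom(V, K^o)) :
    lker R == 0%VS -> \dim (limg (\1 - R)%VF) = 1%N ->
    l != 0 -> l \in limg (\1 - dual_map R)%VF ->
  exists c, x - dual_map R x = c *: l.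
Proof.
move=> kerR dim1 l_neq0 /memv_imgP [y _ ly].
have {}ly : l = y - dual_map R y by rewrite ly add_lfunE opp_lfunE id_lfunE.
pose u := vpick (limg (\1 - R)%VF).
have u_neq0 : u != 0 by rewrite vpick0 -dimv_eq0 dim1.
have imE : limg (\1 - R)%VF = <[u]>%VS.
  apply/esym/eqP; rewrite eqEdim dim_vline u_neq0 dim1 leqnn andbT.
  by rewrite -memvE memv_pick.
have sub_dualE v : exists k,
    forall z : 'Hom(V, K^o), (z - dual_map R z) v = k * z u.
  have /vlineP [k ek] : (\1 - R)%VF ((R^-1)%VF v) \in <[u]>%VS.
    by rewrite -imE memv_img ?memvf.
  (* [k] is the coordinate along [u] of R^-1 v - v, the opposite of the vector at which [z] is
     evaluated. *)
  exists (- k) => z; rewrite add_lfunE opp_lfunE dual_mapE -linearB.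
  have -> : v - (R^-1)%VF v = - k *: u.
    by rewrite scaleNr -ek add_lfunE opp_lfunE id_lfunE lker0_lfunVK // opprB.
  by rewrite linearZ.
(* If [y] killed [u], then l = y - R y would vanish at every vector. *)
have yu_neq0 : y u != 0.
  apply: contraNneq l_neq0 => yu0; apply/eqP/lfunP => v.
  by have [k ek] := sub_dualE v; rewrite ly ek yu0 mulr0 lfunE.
exists (x u / y u); apply/lfunP => v.
have [k ek] := sub_dualE v.
by rewrite ly scale_lfunE !ek /GRing.scale /= mulrCA divfK.
Qed.

Theorem theorem2p7 (K : closedFieldType) (charK : [pchar K] =i pred0)
    (V : vectType K)
    (n : nat) (X : n.-tuple 'Hom(V, K^o)) (basisX : basis_of fullv X)
    (R : 'End(V)) (reflR : pseudo_reflection R)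
    (l : 'Hom(V, K^o)) (l_neq0 : l != 0)
    (l_im : l \in limg (\1 - dual_map R)%VF) :
  exists D : {linear {mpoly K[n]} -> {mpoly K[n]}},
    twisted_derivation (poly_map X R) D /\
    (forall f : {mpoly K[n]}, poly_map X R f = f - D f * form_poly X l).
Proof.
case: reflR => kerR _ dim1.
apply: twisted_derivation_quotient; first exact: form_poly_neq0.
apply: dvd_sub_lrmorphism => i.
have [c ec] :=
  sub_dual_map_colinear _ _ _ _ X`_i kerR dim1 l_neq0 l_im.
(* Both sides have degree one, so the quotient for a variable is a constant. *)
exists c%:MP.
rewrite -(form_polyX basisX) /= (poly_map_form basisX).
by rewrite mul_mpolyC -[X in form_poly _ X - _](subrK (dual_map R X`_i)) ec
  form_poly_linear addrK.
Qed.
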